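(* Let $\tau>0$ be fixed and let $(\mathbf{X}^{m},\kappa^m)_{m\ge 0}\subset[V^h]^2\times V^h$ be a solution of the BGN/PC scheme, with predictors $\widetilde{\mathbf{X}}^{m+\frac12}$. Assume: (1) As $m\to+\infty$, $\mathbf{X}^{m}$ converges to an equilibrium state $\Gamma^e:=\mathbf{X}^e\in [V^h]^2$, and $\kappa^m$ converges to some $\kappa^e\in V^h$. Moreover, the predictor $\widetilde{\mathbf{X}}^{m+\frac{1}{2}}$ also converges to the same equilibrium $\Gamma^e$ (i.e. to $\mathbf{X}^e$). (2) The equilibrium polygon $\Gamma^e$ is non-degenerate in the sense that, with $\mathbf{h}_j^e:=\mathbf{X}^e(\rho_j)-\mathbf{X}^e(\rho_{j-1})$, $1\le j\le N$, $$\min_{1\le j\le N}|\mathbf{h}_j^e|>0\quad\text{and}\quad \dim\bigl( \mathrm{Span}\{\mathbf{h}^{e}_j\}_{j=1}^{N}\bigr)=2.$$ Then, with $\mathbf{h}_j^m:=\mathbf{X}^m(\rho_j)-\mathbf{X}^m(\rho_{j-1})$, the mesh ratio $\Psi^m:=\dfrac{\max_{1\le j\le N}|\mathbf{h}_j^m|}{\min_{1\le j\le N}|\mathbf{h}_j^m|}$ satisfies $$\lim_{m\to +\infty}\Psi^m=\Psi^e:=\frac{\max_{1\le j\le N}|\mathbf{h}_j^e|}{\min_{1\le j\le N}|\mathbf{h}_j^e|}=1.$$ Moreover, the equilibrium state $\Gamma^e$ is a regular $N$-polygon.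
   Context: Finite element space: $\mathbb{I}=[0,1]=\bigcup_{j=1}^N I_j$, $N\ge 3$, $I_j=[\rho_{j-1},\rho_j]$, $0=\rho_0<\rho_1<\dots<\rho_N=1$, and $V^h:=\{u\in C(\mathbb{I}): u|_{I_j}\text{ is linear for } j=1,\dots,N,\ u(\rho_0)=u(\rho_N)\}$ (real-valued, a finite-dimensional space). An element $\mathbf{X}\in[V^h]^2$ describes a closed polygonal curve $\Gamma$ in $\mathbb{R}^2$ with vertices $\mathbf{X}(\rho_j)$ and side vectors $\mathbf{h}_j=\mathbf{X}(\rho_j)-\mathbf{X}(\rho_{j-1})$. The polygons approximate simple closed curves, and the vertices of the initial polygon are ordered clockwise along the initial curve. For a polygon $\Gamma$ described by $\mathbf{X}\in[V^h]^2$ with all $|\mathbf{h}_j|>0$: - the (outward) unit normal $\mathbf{n}$ is the piecewise constant vector $\mathbf{n}|_{I_j}=-\mathbf{h}_j^\perp/|\mathbf{h}_j|$, where $\cdot^\perp$ denotes clockwise rotation by $\pi/2$; - $\partial_s$ is defined piecewise by $\partial_s f|_{I_j}=\partial_\rho f/|\partial_\rho\mathbf{X}|=(\rho_j-\rho_{j-1})\,\partial_\rho f|_{I_j}/|\mathbf{h}_j|$; - $(u,v)_\Gamma=\int_{\mathbb{I}} u\cdot v\,|\partial_\rho\mathbf{X}|\,d\rho$ is the $L^2$ inner product over $\Gamma$; - the mass-lumped inner product is $(u,v)^h_\Gamma:=\frac12\sum_{j=1}^N|\mathbf{h}_j|\,[(u\cdot v)(\rho_j^-)+(u\cdot v)(\rho_{j-1}^+)]$,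 for scalar/vector piecewise continuous $u,v$ with possible jumps at the nodes, where $u(\rho_j^\pm)=\lim_{\rho\to\rho_j^\pm}u(\rho)$. First-order BGN scheme with initial data $\mathbf{X}^m$ (polygon $\Gamma^m$, normal $\mathbf{n}^m$, with $\partial_s$ taken on $\Gamma^m$) and time step $\sigma$: find $(\mathbf{Y},\eta)\in[V^h]^2\times V^h$ such that $\bigl(\frac{\mathbf{Y}-\mathbf{X}^m}{\sigma},\varphi^h\mathbf{n}^m\bigr)^h_{\Gamma^m}+(\partial_s\eta,\partial_s\varphi^h)_{\Gamma^m}=0$ for all $\varphi^h\in V^h$ and $(\eta,\mathbf{n}^m\cdot\boldsymbol{\omega}^h)^h_{\Gamma^m}-(\partial_s\mathbf{Y},\partial_s\boldsymbol{\omega}^h)_{\Gamma^m}=0$ for all $\boldsymbol{\omega}^h\in[V^h]^2$. BGN/PC scheme: given $(\mathbf{X}^0,\kappa^0)\in[V^h]^2\times V^h$, for each $m\ge0$ let the predictor $\widetilde{\mathbf{X}}^{m+\frac12}:=\mathbf{Y}$ be the solution of the first-order BGN scheme with initial data $\mathbf{X}^m$ and time step $\sigma=\tau/2$, describing the polygon $\widetilde\Gamma^{m+\frac12}$ with unit normal $\widetilde{\mathbf{n}}^{m+\frac12}$; then $(\mathbf{X}^{m+1},\kappa^{m+1})\in[V^h]^2\times V^h$ satisfies $$\Bigl(\tfrac{\mathbf{X}^{m+1}-\mathbf{X}^{m}}{\tau},\varphi^h\, \widetilde{\mathbf{n}}^{m+\frac{1}{2}} \Bigr)^h_{\widetilde{\Gamma}^{m+\frac{1}{2}}}+\Bigl(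 \partial_s\bigl(\tfrac{\kappa^{m+1}+\kappa^{m}}{2}\bigr),\partial_s\varphi^h \Bigr)_{\widetilde{\Gamma}^{m+\frac{1}{2}}}=0\quad \forall\, \varphi^h\in V^h,$$ $$\Bigl(\tfrac{\kappa^{m+1}+\kappa^{m}}{2},\widetilde{\mathbf{n}}^{m+\frac{1}{2}}\cdot \boldsymbol{\omega}^h\Bigr)_{\widetilde{\Gamma}^{m+\frac{1}{2}}}^h-\Bigl(\partial_s\bigl(\tfrac{ \mathbf{X}^{m+1}+ \mathbf{X}^{m}}{2}\bigr),\partial_s\boldsymbol{\omega}^h\Bigr)_{\widetilde{\Gamma}^{m+\frac{1}{2}}}=0 \quad \forall\, \boldsymbol{\omega}^h\in [V^h]^2,$$ where $\partial_s$, both inner products and the normal are taken with respect to $\widetilde\Gamma^{m+\frac12}$. Standing assumption: the polygons $\Gamma^m$ (and the predictors, so that their normals are defined) have no degenerate sides, i.e. all side vectors are nonzero. A polygon is regular if all its sides have equal length and all its interior angles are equal. *)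

(* Defs.v *)
From mathcomp Require Import all_boot all_order all_algebra.
From mathcomp Require Import all_classical all_reals all_analysis.

Set Implicit Arguments.
Unset Strict Implicit.
Unset Printing Implicit Defensive.

Import Order.TTheory GRing.Theory Num.Theory.
Import numFieldNormedType.Exports.

Local Open Scope classical_set_scope.
Local Open Scope ring_scope.

(** Plane vectors are row vectors ['rV[R]_2]. The library norm on this type is
    the max norm, so the Euclidean length is defined separately. *)

Definition dot (R : realType) (u v : 'rV[R]_2) : R := \sum_(i < 2) u 0 i * v 0 i.

Definition enorm (R : realType) (u : 'rV[R]_2) : R := Num.sqrt (dot u u).

Definition cross (R : realType) (u v : 'rV[R]_2) : R :=
  u 0 0 * v 0 1 - u 0 1 * v 0 0.

(** Clockwise rotation by [pi / 2]: [(x, y)] is sent to [(y, - x)]. *)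
Definition perp (R : realType) (u : 'rV[R]_2) : 'rV[R]_2 :=
  \row_(i < 2) (if i == 0 then u 0 1 else - u 0 0).

(** The angle in [0, 2 pi) by which [u] has to be turned counterclockwise to
    point in the direction of [v] (for nonzero [u] and [v]). *)
Definition ccw_angle (R : realType) (u v : 'rV[R]_2) : R :=
  let a := acos (dot u v / (enorm u * enorm v)) in
  if 0 <= cross u v then a else 2 * pi - a.

(** Only the nodes [rho 0, ..., rho N] are relevant. Elements, and hence sides,
    are numbered from 0: element [j < N] is the interval [rho j, rho j.+1]. *)
Definition partition01 (R : realType) (N : nat) (rho : nat -> R) : Prop :=
  [/\ rho 0%N = 0, rho N = 1 & forall j, (j < N)%N -> rho j < rho j.+1].

(** Elements of [V^h] are functions on [0, 1], encoded as functions on [R] whose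
    values outside [0, 1] play no role. *)
Definition Vh (R : realType) (N : nat) (rho : nat -> R) (u : R -> R) : Prop :=
  [/\ {within `[0, 1], continuous u},
      forall j, (j < N)%N -> exists a b : R,
        forall r, rho j <= r <= rho j.+1 -> u r = a + b * r
    & u (rho 0%N) = u (rho N)].

Definition Vh2 (R : realType) (N : nat) (rho : nat -> R) (X : R -> 'rV[R]_2)
    : Prop :=
  forall i : 'I_2, Vh N rho (fun r => X r 0 i).

Definition side (R : realType) (rho : nat -> R) (X : R -> 'rV[R]_2) (j : nat)
    : 'rV[R]_2 :=
  X (rho j.+1) - X (rho j).

Definition nondegenerate_sides (R : realType) (N : nat) (rho : nat -> R)
    (X : R -> 'rV[R]_2) : Prop :=
  forall j, (j < N)%N -> side rho X j != 0.

(** The unit normal is only determined in the interior of each element; it is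
    set to 0 at the nodes, where it enters the scheme through its one-sided
    limits only. *)
Definition normal (R : realType) (N : nat) (rho : nat -> R)
    (X : R -> 'rV[R]_2) (r : R) : 'rV[R]_2 :=
  \sum_(j < N | rho j < r < rho j.+1)
    - ((enorm (side rho X j))^-1 *: perp (side rho X j)).

Definition ds (R : realType) (V : normedModType R) (X : R -> 'rV[R]_2)
    (f : R -> V) (r : R) : V :=
  (enorm (derive1 X r))^-1 *: derive1 f r.

(** In the two inner products over the polygon [X], the argument [w] is the
    pointwise product [u . v] of the two factors. *)
Definition curve_ip (R : realType) (X : R -> 'rV[R]_2) (w : R -> R) : R :=
  \int[lebesgue_measure]_(r in `[0, 1]) (w r * enorm (derive1 X r)).

Definition lumped_ip (R : realType) (N : nat) (rho : nat -> R)
    (X : R -> 'rV[R]_2) (w : R -> R) : R :=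
  2^-1 * \sum_(j < N) enorm (side rho X j) *
    (lim (w r @[r --> (rho j.+1)^'-]) + lim (w r @[r --> (rho j)^'+])).

(** The pair of variational equations shared by the first-order scheme and the
    corrector, on the polygon [G]: [v] is the discrete velocity, and the
    curvature [k] is tested against the curve [Z]. *)
Definition weak_equations (R : realType) (N : nat) (rho : nat -> R)
    (G v : R -> 'rV[R]_2) (k : R -> R) (Z : R -> 'rV[R]_2) : Prop :=
  (forall phi : R -> R, Vh N rho phi ->
     lumped_ip N rho G (fun r => dot (v r) (phi r *: normal N rho G r))
     + curve_ip G (fun r => ds G k r * ds G phi r) = 0) /\
  (forall omega : R -> 'rV[R]_2, Vh2 N rho omega ->
     lumped_ip N rho G (fun r => k r * dot (normal N rho G r) (omega r))
     - curve_ip G (fun r => dot (ds G Z r) (ds G omega r)) = 0).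

Definition bgn_step (R : realType) (N : nat) (rho : nat -> R) (sigma : R)
    (Xm Y : R -> 'rV[R]_2) (eta : R -> R) : Prop :=
  [/\ Vh2 N rho Y, Vh N rho eta
    & weak_equations N rho Xm (fun r => sigma^-1 *: (Y r - Xm r)) eta Y].

(** [Xt m] is the predictor at time level [m + 1/2]. *)
Definition bgn_pc_solution (R : realType) (N : nat) (rho : nat -> R) (tau : R)
    (X : nat -> R -> 'rV[R]_2) (kappa : nat -> R -> R)
    (Xt : nat -> R -> 'rV[R]_2) : Prop :=
  (forall m, Vh2 N rho (X m) /\ Vh N rho (kappa m)) /\
  (forall m,
     (exists eta : R -> R, bgn_step N rho (tau / 2) (X m) (Xt m) eta) /\
     weak_equations N rho (Xt m)
       (fun r => tau^-1 *: (X m.+1 r - X m r))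
       (fun r => (kappa m.+1 r + kappa m r) / 2)
       (fun r => 2^-1 *: (X m.+1 r + X m r))).

(** The maximum and minimum below are over a nonempty range, since [0 < N]. *)
Definition max_side (R : realType) (N : nat) (rho : nat -> R)
    (X : R -> 'rV[R]_2) : R :=
  \big[Num.max/enorm (side rho X 0)]_(j < N) enorm (side rho X j).

Definition min_side (R : realType) (N : nat) (rho : nat -> R)
    (X : R -> 'rV[R]_2) : R :=
  \big[Num.min/enorm (side rho X 0)]_(j < N) enorm (side rho X j).

Definition mesh_ratio (R : realType) (N : nat) (rho : nat -> R)
    (X : R -> 'rV[R]_2) : R :=
  max_side N rho X / min_side N rho X.

(** The angle at the vertex between sides [j] and [j + 1 mod N], measured on the
    right of the direction of travel. Vertices are ordered clockwise, so this is
    the side of the interior; traversing a simple polygon the other way replaces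
    all angles [a] by [2 pi - a], so whether all the angles are equal does not
    depend on the orientation. *)
Definition interior_angle (R : realType) (N : nat) (rho : nat -> R)
    (X : R -> 'rV[R]_2) (j : nat) : R :=
  ccw_angle (- side rho X j) (side rho X (j.+1 %% N)).

Definition regular_polygon (R : realType) (N : nat) (rho : nat -> R)
    (X : R -> 'rV[R]_2) : Prop :=
  (forall i j, (i < N)%N -> (j < N)%N ->
     enorm (side rho X i) = enorm (side rho X j)) /\
  (forall i j, (i < N)%N -> (j < N)%N ->
     interior_angle N rho X i = interior_angle N rho X j).

(* Main.v *)
Require Import Defs.
From mathcomp Require Import all_boot all_order all_algebra.
From mathcomp Require Import all_classical all_reals all_analysis.
From mathcomp Require Import measurable_realfun ring lra.

(** Tested with functions of [V^h], the corrector equations become identities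
    between nodal values, in which one can let [m] tend to infinity. The discrete
    velocity tends to 0, so testing the limit of the first identity with [kappae]
    shows that [kappae] is a constant [c]. Testing the limit of the second one
    with hat functions gives, for consecutive sides [h], [h'] of the equilibrium,
    [- (c / 2) (h + h')^perp = h / |h| - h' / |h'|]. The right-hand side is
    orthogonal to [h / |h| + h' / |h'|], hence [c (|h| - |h'|) (h x h') = 0].
    If [c = 0], all the sides have the same direction, which the span condition
    excludes; if [h x h' = 0], then [h / |h| = h' / |h'|] and again [c = 0]. So
    all the sides have the same length [L], and the identity then expresses
    [h . h'] and [h x h'] in terms of [c] and [L]. *)

Set Implicit Arguments.
Unset Strict Implicit.
Unset Printing Implicit Defensive.

Import Order.TTheory GRing.Theory Num.Theory.
Import numFieldNormedType.Exports.

Local Open Scope classical_set_scope.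
Local Open Scope ring_scope.

(** * Integrals of step functions *)

Lemma integrable_setU d (T : measurableType d) (R : realType)
    (mu : {measure set T -> \bar R}) (A B : set T) (f : T -> \bar R) :
  measurable A -> measurable B ->
  mu.-integrable A f -> mu.-integrable B f -> mu.-integrable (A `|` B) f.
Proof.
move=> mA mB /integrableP[mfA fA] /integrableP[mfB fB]; apply/integrableP.
have /(measurable_funU _ mA mB) mf := conj mfA mfB.
split=> //; have -> : A `|` B = A `|` (B `\` A) by rewrite setUDr setDv setD0.
have sub : A `|` B `\` A = A `|` B by rewrite setUDr setDv setD0.
rewrite ge0_integral_setU//=; last 3 first.
- exact: measurableD.
- rewrite sub; exact: measurableT_comp.
- by apply/disj_setPS; rewrite setDE setICA setICr setI0.
rewrite lte_add_pinfty//; apply: le_lt_trans fB.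
apply: ge0_subset_integral => //; first exact: measurableD.
exact: measurableT_comp.
Qed.

Lemma integrable_cst_on (R : realType) (i : interval R) (f : R -> R) (c : R) :
  (lebesgue_measure [set` i] < +oo)%E ->
  (forall x, x \in i -> f x = c) ->
  lebesgue_measure.-integrable [set` i] (EFin \o f).
Proof.
move=> fin fc.
apply: (eq_integrable _ (EFin \o cst c)) => //.
  by move=> x; rewrite inE/= => xi; rewrite fc.
apply: measurable_bounded_integrable => //.
exact: bounded_cst.
Qed.

(** Nodes are null sets, so the values of [w] there may be arbitrary. The induction appends one
    element at a time. It carries integrability and the order of the endpoints along because
    additivity of the integral over adjacent intervals asks for both. *)
Lemma step_integral (R : realType) (n : nat) (a c : nat -> R) (w : R -> R) :
  (forall j, (j < n)%N -> a j < a j.+1) ->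
  (forall j x, (j < n)%N -> a j < x < a j.+1 -> w x = c j) ->
  a 0%N <= a n /\
  lebesgue_measure.-integrable `[a 0%N, a n] (EFin \o w) /\
  \int[lebesgue_measure]_(x in `[a 0%N, a n]) w x
    = \sum_(j < n) c j * (a j.+1 - a j).
Proof.
elim: n => [|n IH] a_lt w_eq.
  rewrite lexx set_itv1 Rintegral_set1 big_ord0; split=> //; split=> //.
  rewrite -set_itv1; apply: (@integrable_cst_on _ _ _ (w (a 0%N))).
    by rewrite set_itv1 lebesgue_measure_set1.
  by move=> x; rewrite in_itv/= -eq_le => /eqP <-.
have [||a_le [wi wE]] := IH.
- by move=> j jn; apply: a_lt; exact: leqW.
- by move=> j x jn; apply: w_eq; exact: leqW.
have an := a_lt n (ltnSn n).
have fino : (lebesgue_measure `]a n, a n.+1[%classic < +oo)%E.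
  by rewrite lebesgue_measure_itv/= lte_fin an -EFinB ltry.
have wc x : x \in `]a n, a n.+1[ -> w x = c n.
  by rewrite in_itv/=; exact: w_eq.
have wo := @integrable_cst_on _ _ w (c n) fino wc.
have wi' : lebesgue_measure.-integrable `[a 0%N, a n.+1] (EFin \o w).
  (* The new piece is an open element, where [w] is constant, together with its right endpoint. *)
  rewrite (@itv_bndbnd_setU _ _ _ (BRight (a n)))//; last by rewrite bnd_simp ltW.
  apply: integrable_setU => //; rewrite -(setUitv1 true); last by rewrite bnd_simp.
  apply: integrable_setU => //.
  rewrite -set_itv1; apply: (@integrable_cst_on _ _ _ (w (a n.+1))).
    by rewrite set_itv1 lebesgue_measure_set1.
  by move=> x; rewrite in_itv/= -eq_le => /eqP <-.
split; [exact: le_trans (ltW an)|split=> //].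
have := @Rintegral_itvB _ w (BLeft (a 0%N)) (BRight (a n.+1)) (a n) wi'.
rewrite !bnd_simp wE => /(_ a_le (ltW an)) /eqP.
rewrite subr_eq => /eqP ->; rewrite big_ord_recr/= addrC; congr (_ + _).
rewrite -Rintegral_itv_bndo_bndc//.
rewrite (@eq_Rintegral _ _ _ _ _ (cst (c n))); last first.
  by move=> x; rewrite inE/= => /wc.
rewrite Rintegral_cst//= lebesgue_measure_itv/= lte_fin an.
by [].
Qed.

(** * Piecewise affine functions *)

(** Stated through nodal values rather than coefficients, and in any module. Scalar and vector
    functions thus share the lemmas below, and sums and multiples need no new coefficients. *)
Definition pw_affine (R : realType) (V : lmodType R) (N : nat)
    (rho : nat -> R) (f : R -> V) : Prop :=
  forall j r, (j < N)%N -> rho j <= r <= rho j.+1 ->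
    f r = f (rho j) + ((r - rho j) / (rho j.+1 - rho j)) *:
          (f (rho j.+1) - f (rho j)).

Lemma pw_affineD (R : realType) (V : lmodType R) N (rho : nat -> R)
    (f g : R -> V) :
  pw_affine N rho f -> pw_affine N rho g ->
  pw_affine N rho (fun r => f r + g r).
Proof.
move=> fA gA j r jN rj; rewrite (fA j r)// (gA j r)// opprD addrACA.
by rewrite -scalerDr; congr (_ + _ *: _); rewrite addrACA.
Qed.

Lemma pw_affineZ (R : realType) (V : lmodType R) N (rho : nat -> R)
    (c : R) (f : R -> V) :
  pw_affine N rho f -> pw_affine N rho (fun r => c *: f r).
Proof.
move=> fA j r jN rj; rewrite (fA j r)// scalerDr; congr (_ + _).
by rewrite -scalerBr !scalerA mulrC.
Qed.

Lemma Vh_pw_affine (R : realType) N (rho : nat -> R) (u : R -> R) :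
  partition01 N rho -> Vh N rho u -> @pw_affine _ R^o N rho u.
Proof.
move=> [_ _ rho_lt] [_ uaff _] j r jN rj.
have lt := rho_lt j jN; have [a [b ab]] := uaff j jN.
rewrite !ab ?lexx ?(ltW lt)// /GRing.scale/=.
by field; rewrite subr_eq0 gt_eqF.
Qed.

Lemma Vh2_pw_affine (R : realType) N (rho : nat -> R) (X : R -> 'rV[R]_2) :
  partition01 N rho -> Vh2 N rho X -> pw_affine N rho X.
Proof.
move=> rhoP XV j r jN rj; apply/rowP => i.
by rewrite !mxE (Vh_pw_affine rhoP (XV i) jN rj).
Qed.

(** The difference quotient is exactly [B] as soon as [h + r] stays between [a] and [b]. *)
Lemma derive1_affine (R : realType) (V : normedModType R) (f : R -> V)
    (a b r : R) (A B : V) :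
  a < r < b -> (forall s, a <= s <= b -> f s = A + s *: B) ->
  derive1 f r = B.
Proof.
move=> /andP[ar rb] fE; rewrite /derive1.
apply: cvg_lim; first exact: norm_hausdorff.
apply: cvg_near_cst.
have hr : \forall h \near 0^', a < h + r < b.
  apply: nbhs_dnbhs; near=> h; apply/andP; split.
  - by rewrite -ltrBlDr; near: h; apply: lt_nbhsr; rewrite subr_lt0.
  - by rewrite -ltrBrDr; near: h; apply: lt_nbhsl; rewrite subr_gt0.
near=> h; have /andP[ah hb] : a < h + r < b by near: h; exact: hr.
have h0 : h != 0 by near: h; exact: nbhs_dnbhs_neq.
rewrite !fE ?(ltW ah) ?(ltW hb) ?(ltW ar) ?(ltW rb)//.
by rewrite opprD addrACA subrr add0r -scalerBl addrK scalerA mulVf// scale1r.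
Unshelve. all: by end_near. Qed.

(** On the element [f] agrees with the affine map [g], which is continuous on the whole line. *)
Lemma pw_affine_cvg_left (R : realType) (V : normedModType R) N (rho : nat -> R)
    (f : R -> V) j :
  partition01 N rho -> pw_affine N rho f -> (j < N)%N ->
  f r @[r --> (rho j.+1)^'-] --> f (rho j.+1).
Proof.
move=> [_ _ rho_lt] fA jN; have lt := rho_lt j jN.
pose g r := f (rho j) + ((r - rho j) / (rho j.+1 - rho j)) *:
          (f (rho j.+1) - f (rho j)).
have <- : g (rho j.+1) = f (rho j.+1).
  by rewrite /g divff ?scale1r ?subrKC// subr_eq0 gt_eqF.
have gc : g r @[r --> (rho j.+1)^'-] --> g (rho j.+1).
  apply: cvg_at_left_filter.
  apply: cvgD; first exact: cvg_cst.
  apply: cvgZr_tmp. apply: cvgMr_tmp. apply: cvgB; [exact: cvg_id|exact: cvg_cst].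
apply: cvg_trans gc; apply: near_eq_cvg; near=> r.
rewrite [RHS](fA j)//; apply/andP; split; near: r.
- exact: nbhs_left_ge.
- exact: nbhs_left_le.
Unshelve. all: by end_near. Qed.

Lemma cvg_dot (R : realType) (T : Type) (F : set_system T) {FF : Filter F}
    (u v : T -> 'rV[R]_2) (a b : 'rV[R]_2) :
  u x @[x --> F] --> a -> v x @[x --> F] --> b ->
  dot (u x) (v x) @[x --> F] --> dot a b.
Proof.
move=> ua vb; apply: cvg_big => [|i _]; first exact: add_continuous.
apply: cvgM.
- exact: (cvg_comp u (fun M : 'rV[R]_2 => M 0 i) ua (@coord_continuous _ _ _ _ _ a)).
- exact: (cvg_comp v (fun M : 'rV[R]_2 => M 0 i) vb (@coord_continuous _ _ _ _ _ b)).
Qed.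

Lemma pw_affine_cvg_right (R : realType) (V : normedModType R) N
    (rho : nat -> R) (f : R -> V) j :
  partition01 N rho -> pw_affine N rho f -> (j < N)%N ->
  f r @[r --> (rho j)^'+] --> f (rho j).
Proof.
move=> [_ _ rho_lt] fA jN; have lt := rho_lt j jN.
pose g r := f (rho j) + ((r - rho j) / (rho j.+1 - rho j)) *:
          (f (rho j.+1) - f (rho j)).
have <- : g (rho j) = f (rho j) by rewrite /g subrr mul0r scale0r addr0.
have gc : g r @[r --> (rho j)^'+] --> g (rho j).
  apply: cvg_at_right_filter.
  apply: cvgD; first exact: cvg_cst.
  by apply: cvgZr_tmp; apply: cvgMr_tmp; apply: cvgB; [exact: cvg_id|exact: cvg_cst].
apply: cvg_trans gc; apply: near_eq_cvg; near=> r.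
rewrite [RHS](fA j)//; apply/andP; split; near: r.
- exact: nbhs_right_ge.
- exact: nbhs_right_ltW.
Unshelve. all: by end_near. Qed.

Lemma derive1_pw_affine (R : realType) (V : normedModType R) N
    (rho : nat -> R) (f : R -> V) j r :
  pw_affine N rho f -> (j < N)%N -> rho j < r < rho j.+1 ->
  derive1 f r = (rho j.+1 - rho j)^-1 *: (f (rho j.+1) - f (rho j)).
Proof.
move=> fA jN rj; have lt := lt_trans (andP rj).1 (andP rj).2.
set B := _ *: _.
apply: (@derive1_affine _ _ f (rho j) (rho j.+1) r (f (rho j) - rho j *: B)) => //.
move=> s sj; rewrite (fA j s)// /B !scalerA -addrA; congr (_ + _).
by rewrite -scaleNr -scalerDl addrC -mulNr -mulrDl.
Qed.

(** * Euclidean length and dot product in the plane *)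

Lemma dotE (R : realType) (u v : 'rV[R]_2) :
  dot u v = u 0 0 * v 0 0 + u 0 1 * v 0 1.
Proof.
by rewrite /dot !big_ord_recl big_ord0 addr0; congr (_ + u 0 _ * v 0 _); apply/val_inj.
Qed.

Lemma dot_ge0 (R : realType) (u : 'rV[R]_2) : 0 <= dot u u.
Proof. by rewrite dotE -!expr2 addr_ge0 ?sqr_ge0. Qed.

Lemma enorm_sqr (R : realType) (u : 'rV[R]_2) :
  enorm u ^+ 2 = u 0 0 ^+ 2 + u 0 1 ^+ 2.
Proof. by rewrite sqr_sqrtr ?dot_ge0// dotE -!expr2. Qed.

Lemma enorm_eq0 (R : realType) (u : 'rV[R]_2) : (enorm u == 0) = (u == 0).
Proof.
apply/eqP/eqP => [u0|->]; last first.
  by rewrite /enorm dotE !mxE !mul0r addr0 sqrtr0.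
have /eqP := enorm_sqr u; rewrite u0 expr0n/= eq_sym paddr_eq0 ?sqr_ge0//.
rewrite !sqrf_eq0 => /andP[/eqP u00 /eqP u01]; apply/rowP => i; rewrite mxE.
by case: i => [[|[|//]] hi]; [rewrite -u00|rewrite -u01]; congr (u 0 _); exact: val_inj.
Qed.

Lemma enorm_gt0 (R : realType) (u : 'rV[R]_2) : (0 < enorm u) = (u != 0).
Proof. by rewrite lt0r enorm_eq0 sqrtr_ge0 andbT. Qed.

Lemma enormZ (R : realType) (c : R) (u : 'rV[R]_2) :
  0 <= c -> enorm (c *: u) = c * enorm u.
Proof.
move=> c0; rewrite /enorm !dotE !mxE.
rewrite (_ : _ + _ = c ^+ 2 * (u 0 0 * u 0 0 + u 0 1 * u 0 1)); last by ring.
by rewrite sqrtrM ?sqr_ge0// sqrtr_sqr ger0_norm.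
Qed.

Lemma dotZl (R : realType) (c : R) (u v : 'rV[R]_2) : dot (c *: u) v = c * dot u v.
Proof. by rewrite !dotE !mxE; ring. Qed.

Lemma dotZr (R : realType) (c : R) (u v : 'rV[R]_2) : dot u (c *: v) = c * dot u v.
Proof. by rewrite !dotE !mxE; ring. Qed.

(** * The two inner products as sums over elements *)

Lemma rho_le (R : realType) N (rho : nat -> R) i j :
  partition01 N rho -> (i <= j <= N)%N -> rho i <= rho j.
Proof.
move=> [_ _ rho_lt] /andP[ij jN]; elim: j ij jN => [|j IH]; first by rewrite leqn0 => /eqP ->.
rewrite leq_eqVlt => /predU1P[->//|ij jN].
by rewrite (le_trans (IH ij (ltnW jN)))// ltW ?rho_lt.
Qed.

Lemma node_in01 (R : realType) N (rho : nat -> R) j :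
  partition01 N rho -> (j <= N)%N -> rho j \in `[0, 1].
Proof.
move=> rhoP jN; have [r0 rN _] := rhoP; rewrite in_itv/= -[X in X <= _]r0 -rN.
by rewrite !(rho_le rhoP) ?jN ?leqnn.
Qed.

(** The open elements are disjoint, so a single term of the sum defining the normal survives. *)
Lemma normal_in (R : realType) N (rho : nat -> R) (X : R -> 'rV[R]_2) j r :
  partition01 N rho -> (j < N)%N -> rho j < r < rho j.+1 ->
  normal N rho X r = - ((enorm (side rho X j))^-1 *: perp (side rho X j)).
Proof.
move=> rhoP jN /andP[jr rj]; rewrite /normal (big_pred1 (Ordinal jN))//.
move=> i /=; apply/idP/eqP => [/andP[ir ri]|->]; last by rewrite /= jr rj.
apply/val_inj/eqP => /=; rewrite eqn_leq; apply/andP; split.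
- rewrite leqNgt; apply/negP => ji.
  have /(rho_le rhoP) : (j.+1 <= i <= N)%N by rewrite ji ltnW.
  by rewrite leNgt (lt_trans ir rj).
- rewrite leqNgt; apply/negP => ij.
  have /(rho_le rhoP) : (i.+1 <= j <= N)%N by rewrite ij ltnW.
  by rewrite leNgt (lt_trans jr ri).
Qed.

(** The parameter length of the element cancels between the derivative of [f] and the speed of
    [X]. *)
Lemma ds_pw_affine (R : realType) (V : normedModType R) N (rho : nat -> R)
    (X : R -> 'rV[R]_2) (f : R -> V) j r :
  pw_affine N rho X -> pw_affine N rho f -> (j < N)%N ->
  rho j < r < rho j.+1 ->
  ds X f r = (enorm (side rho X j))^-1 *: (f (rho j.+1) - f (rho j)).
Proof.
move=> XA fA jN rj; have /andP[jr rj'] := rj.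
have lt : 0 < rho j.+1 - rho j by rewrite subr_gt0 (lt_trans jr).
rewrite /ds (derive1_pw_affine XA jN rj) (derive1_pw_affine fA jN rj).
rewrite enormZ ?invr_ge0 ?ltW// invfM invrK scalerA mulrAC divff ?gt_eqF//.
by rewrite mul1r.
Qed.

Lemma curve_ip_step (R : realType) N (rho : nat -> R) (G : R -> 'rV[R]_2)
    (w : R -> R) (c : nat -> R) :
  partition01 N rho -> pw_affine N rho G ->
  (forall j r, (j < N)%N -> rho j < r < rho j.+1 -> w r = c j) ->
  curve_ip G w = \sum_(j < N) c j * enorm (side rho G j).
Proof.
move=> [r0 rN rho_lt] GA wc; rewrite /curve_ip -r0 -rN.
(* The value of the integrand on element [j]: the speed of [G] is the length of the side divided by
   that of the element. *)
pose c' j := c j * ((rho j.+1 - rho j)^-1 * enorm (side rho G j)).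
have [|_ [_]] := @step_integral _ N rho c'
    (fun r => w r * enorm (derive1 G r)) rho_lt.
  move=> j r jN rj; rewrite (wc j)// (derive1_pw_affine GA jN rj) enormZ//.
  by rewrite invr_ge0 subr_ge0 ltW ?rho_lt.
rewrite r0 rN => ->; apply: eq_bigr => j _; rewrite /c'; field.
by rewrite subr_eq0 gt_eqF ?rho_lt.
Qed.

Lemma lumped_ip_lim (R : realType) N (rho : nat -> R) (G : R -> 'rV[R]_2)
    (w : R -> R) (l r : nat -> R) :
  (forall j, (j < N)%N -> w x @[x --> (rho j.+1)^'-] --> l j) ->
  (forall j, (j < N)%N -> w x @[x --> (rho j)^'+] --> r j) ->
  lumped_ip N rho G w =
    2^-1 * \sum_(j < N) enorm (side rho G j) * (l j + r j).
Proof.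
move=> wl wr; congr (_ * _); apply: eq_bigr => j _.
by congr (_ * (_ + _)); apply: cvg_lim;
  [exact: Rhausdorff|exact: wl|exact: Rhausdorff|exact: wr].
Qed.

Lemma near_element_left (R : realType) N (rho : nat -> R) j :
  partition01 N rho -> (j < N)%N ->
  \forall r \near (rho j.+1)^'-, rho j < r < rho j.+1.
Proof.
move=> [_ _ rho_lt] jN; near=> r; apply/andP; split; near: r.
- exact/nbhs_left_gt/rho_lt.
- exact: nbhs_left_lt.
Unshelve. all: by end_near. Qed.

Lemma near_element_right (R : realType) N (rho : nat -> R) j :
  partition01 N rho -> (j < N)%N ->
  \forall r \near (rho j)^'+, rho j < r < rho j.+1.
Proof.
move=> [_ _ rho_lt] jN; near=> r; apply/andP; split; near: r.
- exact: nbhs_right_gt.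
- exact/nbhs_right_lt/rho_lt.
Unshelve. all: by end_near. Qed.

(** The length of the side in the lumped weight cancels the one in the normal. Both weak equations
    use this: the first with a velocity and a test function, the second with the test field as [v]
    and the curvature as [phi]. *)
Lemma lumped_normal (R : realType) N (rho : nat -> R) (G v : R -> 'rV[R]_2)
    (phi : R -> R) :
  partition01 N rho -> nondegenerate_sides N rho G ->
  pw_affine N rho v -> @pw_affine _ R^o N rho phi ->
  lumped_ip N rho G (fun r => phi r * dot (v r) (normal N rho G r)) =
  2^-1 * \sum_(j < N) - (phi (rho j.+1) * dot (v (rho j.+1)) (perp (side rho G j))
           + phi (rho j) * dot (v (rho j)) (perp (side rho G j))).
Proof.
move=> rhoP Gnd vA phiA.
(* The constant value of the normal inside element [j]. One-sided limits see this value and not the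
   default 0 at the nodes. *)
pose nu j := - ((enorm (side rho G j))^-1 *: perp (side rho G j)).
rewrite (@lumped_ip_lim _ _ _ _ _
  (fun j => phi (rho j.+1) * dot (v (rho j.+1)) (nu j))
  (fun j => phi (rho j) * dot (v (rho j)) (nu j))).
- congr (_ * _); apply: eq_bigr => j _.
  rewrite /nu -scaleNr !dotZr; field.
  by rewrite enorm_eq0 Gnd.
- move=> j jN.
  have h : phi r * dot (v r) (nu j) @[r --> (rho j.+1)^'-] -->
           phi (rho j.+1) * dot (v (rho j.+1)) (nu j).
    apply: cvgM; first exact: (pw_affine_cvg_left rhoP phiA).
    by apply: cvg_dot; [exact: (pw_affine_cvg_left rhoP vA)|exact: cvg_cst].
  apply: cvg_trans h; apply: near_eq_cvg; near=> r.
  by rewrite (normal_in _ rhoP jN)//; near: r; exact: (near_element_left rhoP jN).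
- move=> j jN.
  have h : phi r * dot (v r) (nu j) @[r --> (rho j)^'+] -->
           phi (rho j) * dot (v (rho j)) (nu j).
    apply: cvgM; first exact: (pw_affine_cvg_right rhoP phiA).
    by apply: cvg_dot; [exact: (pw_affine_cvg_right rhoP vA)|exact: cvg_cst].
  apply: cvg_trans h; apply: near_eq_cvg; near=> r.
  by rewrite (normal_in _ rhoP jN)//; near: r; exact: (near_element_right rhoP jN).
Unshelve. all: by end_near. Qed.

(** * The weak equations in terms of nodal values *)

(** The left-hand side of the first weak equation after evaluation of both inner products. The cross
    products are dot products with the rotated sides, and the leading minus sign is that of the
    normal. *)
Definition nodal_velocity_form (R : realType) (N : nat) (rho : nat -> R)
    (G v : R -> 'rV[R]_2) (k phi : R -> R) : R :=
  - (2^-1 * \sum_(j < N) (phi (rho j.+1) * cross (v (rho j.+1)) (side rho G j)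
                        + phi (rho j) * cross (v (rho j)) (side rho G j)))
  + \sum_(j < N) (k (rho j.+1) - k (rho j)) * (phi (rho j.+1) - phi (rho j))
                 / enorm (side rho G j).

(** The same for the second equation. The curve [Z] is kept apart from the polygon [G], since the
    corrector tests an averaged curve on the predictor polygon. *)
Definition nodal_curvature_form (R : realType) (N : nat) (rho : nat -> R)
    (G : R -> 'rV[R]_2) (k : R -> R) (Z omega : R -> 'rV[R]_2) : R :=
  - (2^-1 * \sum_(j < N) (k (rho j.+1) * cross (omega (rho j.+1)) (side rho G j)
                        + k (rho j) * cross (omega (rho j)) (side rho G j)))
  - \sum_(j < N) dot (side rho Z j) (side rho omega j) / enorm (side rho G j).

Lemma dotC (R : realType) (u v : 'rV[R]_2) : dot u v = dot v u.
Proof. by rewrite !dotE; ring. Qed.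

Lemma dot_perp (R : realType) (u v : 'rV[R]_2) : dot u (perp v) = cross u v.
Proof. by rewrite dotE !mxE/= mulrN. Qed.

Lemma weak_equations_nodal (R : realType) N (rho : nat -> R)
    (G v : R -> 'rV[R]_2) (k : R -> R) (Z : R -> 'rV[R]_2) :
  partition01 N rho -> nondegenerate_sides N rho G ->
  pw_affine N rho G -> pw_affine N rho v -> @pw_affine _ R^o N rho k ->
  pw_affine N rho Z -> weak_equations N rho G v k Z ->
  (forall phi, Vh N rho phi -> nodal_velocity_form N rho G v k phi = 0) /\
  (forall omega, Vh2 N rho omega ->
     nodal_curvature_form N rho G k Z omega = 0).
Proof.
move=> rhoP Gnd GA vA kA ZA [eq1 eq2]; split.
- move=> phi phiV; rewrite -[RHS](eq1 _ phiV).
  have phiA := Vh_pw_affine rhoP phiV.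
  congr (_ + _).
    rewrite (_ : (fun r => _) =
      fun r => phi r * dot (v r) (normal N rho G r)); last first.
      by apply/funext => r; rewrite dotZr.
    rewrite lumped_normal// -mulrN sumrN; congr (_ * - _).
    by apply: eq_bigr => j _; rewrite !dot_perp.
  (* Each arclength derivative contributes an inverse length of the side, and the measure cancels
     one of the two. *)
  rewrite (@curve_ip_step _ N rho G _ (fun j =>
    (enorm (side rho G j))^-1 *: (k (rho j.+1) - k (rho j)) *
    ((enorm (side rho G j))^-1 *: (phi (rho j.+1) - phi (rho j)))))//.
    apply: eq_bigr => j _; rewrite /GRing.scale/=; field.
    by rewrite enorm_eq0 Gnd.
  by move=> j r jN rj; rewrite (ds_pw_affine GA kA jN rj) (ds_pw_affine GA phiA jN rj).
- move=> omega omegaV; rewrite -[RHS](eq2 _ omegaV).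
  have oA := Vh2_pw_affine rhoP omegaV.
  congr (_ - _).
    rewrite (_ : (fun r => _) =
      fun r => k r * dot (omega r) (normal N rho G r)); last first.
      by apply/funext => r; rewrite dotC.
    rewrite lumped_normal// -mulrN sumrN; congr (_ * - _).
    by apply: eq_bigr => j _; rewrite !dot_perp.
  rewrite (@curve_ip_step _ N rho G _ (fun j =>
    dot ((enorm (side rho G j))^-1 *: side rho Z j)
        ((enorm (side rho G j))^-1 *: side rho omega j)))//.
    apply: eq_bigr => j _; rewrite dotZl dotZr; field.
    by rewrite enorm_eq0 Gnd.
  by move=> j r jN rj; rewrite (ds_pw_affine GA ZA jN rj) (ds_pw_affine GA oA jN rj).
Qed.

(** * Passage to the limit in the nodal forms *)

Lemma cvg_cross (R : realType) (T : Type) (F : set_system T) {FF : Filter F}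
    (u v : T -> 'rV[R]_2) (a b : 'rV[R]_2) :
  u x @[x --> F] --> a -> v x @[x --> F] --> b ->
  cross (u x) (v x) @[x --> F] --> cross a b.
Proof.
move=> ua vb.
have uc i : u x 0 i @[x --> F] --> a 0 i.
  exact: (cvg_comp u (fun M : 'rV[R]_2 => M 0 i) ua (@coord_continuous _ _ _ _ _ a)).
have vc i : v x 0 i @[x --> F] --> b 0 i.
  exact: (cvg_comp v (fun M : 'rV[R]_2 => M 0 i) vb (@coord_continuous _ _ _ _ _ b)).
by apply: cvgB; apply: cvgM.
Qed.

Lemma cvg_enorm (R : realType) (T : Type) (F : set_system T) {FF : Filter F}
    (u : T -> 'rV[R]_2) (a : 'rV[R]_2) :
  u x @[x --> F] --> a -> enorm (u x) @[x --> F] --> enorm a.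
Proof.
move=> ua.
exact: (cvg_comp _ _ (cvg_dot ua ua) (@sqrt_continuous R (dot a a))).
Qed.

Lemma cvg_rsum (R : realType) (T : Type) (F : set_system T) {FF : Filter F}
    (n : nat) (f : 'I_n -> T -> R) (l : 'I_n -> R) :
  (forall i, f i x @[x --> F] --> l i) ->
  \sum_(i < n) f i x @[x --> F] --> \sum_(i < n) l i.
Proof. by move=> fl; apply: cvg_big => //; exact: add_continuous. Qed.

(** The mode of convergence seen by the nodal forms, which are finite sums over nodal values. *)
Definition nodal_cvg (R : realType) (V : topologicalType) (N : nat)
    (rho : nat -> R) (f : nat -> R -> V) (fe : R -> V) : Prop :=
  forall j, (j <= N)%N -> f m (rho j) @[m --> \oo] --> fe (rho j).

Lemma cvg_side (R : realType) N (rho : nat -> R) (f : nat -> R -> 'rV[R]_2)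
    (fe : R -> 'rV[R]_2) j :
  nodal_cvg N rho f fe -> (j < N)%N ->
  side rho (f m) j @[m --> \oo] --> side rho fe j.
Proof. by move=> fc jN; apply: cvgB; apply: fc => //; exact: ltnW. Qed.

(** The form is continuous in the nodal values wherever no side vanishes; the limit polygon has
    nonzero sides, so the divisions pass to the limit. *)
Lemma nodal_velocity_form_cvg (R : realType) N (rho : nat -> R)
    (G v : nat -> R -> 'rV[R]_2) (Ge ve : R -> 'rV[R]_2)
    (k : nat -> R -> R) (ke phi : R -> R) :
  nondegenerate_sides N rho Ge -> nodal_cvg N rho G Ge ->
  nodal_cvg N rho v ve -> nodal_cvg N rho k ke ->
  nodal_velocity_form N rho (G m) (v m) (k m) phi @[m --> \oo] -->
  nodal_velocity_form N rho Ge ve ke phi.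
Proof.
move=> nd Gc vc kc; apply: cvgD.
  apply: cvgN; apply: cvgMl_tmp; apply: cvg_rsum => -[j jN] /=; apply: cvgD; apply: cvgMl_tmp;
  by apply: cvg_cross; [apply: vc => //; exact: ltnW|exact: (cvg_side Gc)].
apply: cvg_rsum => -[j jN] /=; apply: cvgM.
  by apply: cvgMr_tmp; apply: cvgB; apply: kc => //; exact: ltnW.
apply: cvgV; first by rewrite enorm_eq0 nd.
by apply: cvg_enorm; exact: (cvg_side Gc).
Qed.

Lemma nodal_curvature_form_cvg (R : realType) N (rho : nat -> R)
    (G Z : nat -> R -> 'rV[R]_2) (Ge Ze omega : R -> 'rV[R]_2)
    (k : nat -> R -> R) (ke : R -> R) :
  nondegenerate_sides N rho Ge -> nodal_cvg N rho G Ge ->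
  nodal_cvg N rho Z Ze -> nodal_cvg N rho k ke ->
  nodal_curvature_form N rho (G m) (k m) (Z m) omega @[m --> \oo] -->
  nodal_curvature_form N rho Ge ke Ze omega.
Proof.
move=> nd Gc Zc kc; apply: cvgB.
  apply: cvgN; apply: cvgMl_tmp; apply: cvg_rsum => -[j jN] /=; apply: cvgD; apply: cvgM;
    [exact: kc| |apply: kc; exact: ltnW|];
  by apply: cvg_cross; [exact: cvg_cst|exact: (cvg_side Gc)].
apply: cvg_rsum => -[j jN] /=; apply: cvgM.
  by apply: cvg_dot; [exact: (cvg_side Zc)|exact: cvg_cst].
apply: cvgV; first by rewrite enorm_eq0 nd.
by apply: cvg_enorm; exact: (cvg_side Gc).
Qed.

Lemma uniform_nodal_cvg (R : realType) (V : uniformType) N (rho : nat -> R)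
    (f : nat -> R -> V) (fe : R -> V) :
  partition01 N rho -> {uniform `[0, 1], f m @[m --> \oo] --> fe} ->
  nodal_cvg N rho f fe.
Proof.
move=> rhoP fc j jN; apply/cvg_entourageP => E entE.
have /fc : nbhs (fe : {uniform` `[0, 1]%classic -> V})
    [set h | forall y, `[0, 1]%classic y -> E (fe y, h y)].
  by apply/uniform_nbhs; exists E; split.
rewrite /= !near_simpl; apply: filterS => m /=.
by apply; exact: (node_in01 rhoP jN).
Qed.

(** * Interpolants and hat functions *)

(* Absolute values, rather than [Num.min] and [Num.max], make continuity immediate. *)
Definition clamp01 (R : realType) (x : R) : R := (1 + `|x| - `|x - 1|) / 2.

Lemma clamp01_le0 (R : realType) (x : R) : x <= 0 -> clamp01 x = 0.
Proof.
by move=> x0; rewrite /clamp01 (ler0_norm x0) ler0_norm; lra.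
Qed.

Lemma clamp01_ge1 (R : realType) (x : R) : 1 <= x -> clamp01 x = 1.
Proof.
by move=> x1; rewrite /clamp01 ger0_norm ?ger0_norm; lra.
Qed.

Lemma clamp01_id (R : realType) (x : R) : 0 <= x <= 1 -> clamp01 x = x.
Proof.
by move=> /andP[x0 x1]; rewrite /clamp01 (ger0_norm x0) ler0_norm; lra.
Qed.

Lemma clamp01_continuous (R : realType) : continuous (@clamp01 R).
Proof.
move=> x; apply: cvgMr_tmp; apply: cvgB.
  by apply: cvgD; [exact: cvg_cst|apply: cvg_norm; exact: cvg_id].
by apply: cvg_norm; apply: cvgB; [exact: cvg_id|exact: cvg_cst].
Qed.

(** A sum of ramps: the term of index [j] grows from 0 to [a j.+1 - a j] across element [j] and is
    constant elsewhere. A single formula on the whole line makes continuity immediate. *)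
Definition interpolant (R : realType) (N : nat) (rho a : nat -> R) (r : R) : R :=
  a 0%N + \sum_(j < N) (a j.+1 - a j) *
            clamp01 ((r - rho j) / (rho j.+1 - rho j)).

(** On element [i] the earlier ramps have already reached 1, the later ones are still 0, and only
    ramp [i] is under way. *)
Lemma clamp01_element (R : realType) N (rho : nat -> R) i j r :
  partition01 N rho -> (i < N)%N -> (j < N)%N -> rho i <= r <= rho i.+1 ->
  clamp01 ((r - rho j) / (rho j.+1 - rho j)) =
  (j < i)%N%:R + (j == i)%:R * ((r - rho i) / (rho i.+1 - rho i)).
Proof.
move=> rhoP iN jN /andP[ir ri]; have [_ _ rho_lt] := rhoP.
have dj : 0 < rho j.+1 - rho j by rewrite subr_gt0 rho_lt.
case: ltngtP => [ji|ij|->].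
- have := @rho_le _ _ _ j.+1 i rhoP; rewrite ji ltnW// => /(_ isT) le.
  rewrite mul0r addr0 clamp01_ge1// ler_pdivlMr// mul1r lerD2r.
  exact: le_trans le ir.
- have := @rho_le _ _ _ i.+1 j rhoP; rewrite ij ltnW// => /(_ isT) le.
  rewrite mul0r addr0 clamp01_le0// ler_pdivrMr// mul0r subr_le0.
  exact: le_trans ri le.
- rewrite add0r mul1r clamp01_id//; have di : 0 < rho i.+1 - rho i.
    by rewrite subr_gt0 rho_lt.
  by rewrite ler_pdivrMr// mul1r lerD2r ri andbT divr_ge0 ?(ltW di)// subr_ge0.
Qed.

Lemma interpolant_node (R : realType) N (rho a : nat -> R) i :
  partition01 N rho -> (i <= N)%N -> interpolant N rho a (rho i) = a i.
Proof.
move=> rhoP iN; have [_ _ rho_lt] := rhoP.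
rewrite /interpolant (eq_bigr (fun j : 'I_N => (a j.+1 - a j) * (j < i)%N%:R)).
  rewrite (eq_bigr (fun j : 'I_N => if (j < i)%N then a j.+1 - a j else 0)).
    rewrite -big_mkcond/= -(big_ord_widen N (fun j => a j.+1 - a j))//.
    rewrite -(big_mkord xpredT (fun j => a j.+1 - a j)) telescope_sumr//.
    by rewrite addrC subrK.
  by move=> j _; case: ifP; rewrite ?mulr1 ?mulr0.
move=> j _; congr (_ * _); have [iN'|] := ltnP i N.
  rewrite (@clamp01_element _ N _ i)// ?lexx/= ?(ltW (rho_lt _ _))//.
  by rewrite subrr mul0r mulr0 addr0.
(* The last node is the left end of no element; there every ramp has reached 1. *)
move=> Ni; have -> : i = N by apply/eqP; rewrite eqn_leq iN Ni.
rewrite ltn_ord clamp01_ge1// ler_pdivlMr ?subr_gt0 ?rho_lt// mul1r lerD2r.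
by apply: (rho_le rhoP); rewrite ltn_ord leqnn.
Qed.

Lemma interpolant_Vh (R : realType) N (rho a : nat -> R) :
  partition01 N rho -> a 0%N = a N -> Vh N rho (interpolant N rho a).
Proof.
move=> rhoP a0N; split; last by rewrite !interpolant_node.
  apply: continuous_subspaceT => x; apply: cvgD; first exact: cvg_cst.
  apply: cvg_rsum => j; apply: cvgMl_tmp.
  have h : (r - rho j) / (rho j.+1 - rho j) @[r --> x] -->
           (x - rho j) / (rho j.+1 - rho j).
    by apply: cvgMr_tmp; apply: cvgB; [exact: cvg_id|exact: cvg_cst].
  exact: (cvg_comp _ _ h (@clamp01_continuous R _)).
move=> i iN.
(* The constant and linear parts in [r] of the formula in [clamp01_element]. *)
exists (a 0%N + \sum_(j < N) (a j.+1 - a j) *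
   ((j < i)%N%:R - (nat_of_ord j == i)%:R * (rho i / (rho i.+1 - rho i)))),
  (\sum_(j < N) (a j.+1 - a j) *
    ((nat_of_ord j == i)%:R / (rho i.+1 - rho i))) => r ri.
rewrite /interpolant -addrA mulr_suml -big_split/=; congr (_ + _).
by apply: eq_bigr => j _; rewrite (clamp01_element rhoP iN _ ri)//; ring.
Qed.

Lemma sum_delta (R : realType) N i (f : nat -> R) :
  (i < N)%N -> \sum_(j < N) f j * (nat_of_ord j == i)%:R = f i.
Proof.
move=> iN; rewrite (bigD1 (Ordinal iN))//= eqxx mulr1 big1 ?addr0// => j ji.
by rewrite (_ : (nat_of_ord j == i) = false) ?mulr0//; exact: negbTE.
Qed.

(* The vertex between sides [i] and [i + 1 mod N] is [rho i.+1]; the hat function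
   there also takes the value 1 at [rho 0] when [i.+1 = N]. *)
Definition hat (R : realType) (N : nat) (rho : nat -> R) (i : nat) : R -> R :=
  interpolant N rho (fun j => (j %% N == i.+1 %% N)%N%:R).

Lemma hat_Vh (R : realType) N (rho : nat -> R) i :
  partition01 N rho -> Vh N rho (hat N rho i).
Proof. by move=> rhoP; apply: interpolant_Vh => //; rewrite modnn mod0n. Qed.

Lemma hat_left (R : realType) N (rho : nat -> R) i j :
  partition01 N rho -> (i < N)%N -> (j < N)%N ->
  hat N rho i (rho j) = (j == i.+1 %% N)%N%:R.
Proof. by move=> rhoP iN jN; rewrite /hat interpolant_node 1?ltnW// modn_small. Qed.

Lemma hat_right (R : realType) N (rho : nat -> R) i j :
  partition01 N rho -> (i < N)%N -> (j < N)%N ->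
  hat N rho i (rho j.+1) = (j == i)%:R.
Proof.
move=> rhoP iN jN; rewrite /hat interpolant_node//.
by rewrite -addn1 -(addn1 i) eqn_modDr !modn_small.
Qed.

Lemma Vh_mulr (R : realType) N (rho : nat -> R) (u : R -> R) (c : R) :
  Vh N rho u -> Vh N rho (fun r => u r * c).
Proof.
move=> [uc ua uN]; split; last by rewrite uN.
  by move=> x; apply: cvgMr_tmp; exact: uc.
move=> j /ua[a [b ab]]; exists (a * c), (b * c) => r /ab ->; ring.
Qed.

(** The test field is the hat function of one vertex times a fixed vector [e]. Only the side
    arriving at the vertex and the side leaving it contribute, with opposite signs in the gradient
    term. As [e] is arbitrary, this is a vector identity. *)
Lemma nodal_curvature_corner (R : realType) N (rho : nat -> R)
    (G : R -> 'rV[R]_2) (k : R -> R) (c : R) i (e : 'rV[R]_2) :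
  partition01 N rho -> (i < N)%N ->
  (forall j, (j <= N)%N -> k (rho j) = c) ->
  (forall omega, Vh2 N rho omega ->
     nodal_curvature_form N rho G k G omega = 0) ->
  c / 2 * (cross e (side rho G i) + cross e (side rho G (i.+1 %% N)))
  + dot (side rho G i) e / enorm (side rho G i)
  - dot (side rho G (i.+1 %% N)) e / enorm (side rho G (i.+1 %% N)) = 0.
Proof.
move=> rhoP iN kc eq0; have i'N : (i.+1 %% N < N)%N by rewrite ltn_mod (leq_ltn_trans _ iN).
pose omega r := hat N rho i r *: e.
have oV : Vh2 N rho omega.
  move=> l; have hV := hat_Vh i rhoP.
  rewrite (_ : (fun r => _) = fun r => hat N rho i r * e 0 l); last first.
    by apply/funext => r; rewrite mxE.
  exact: Vh_mulr.
pose s j := side rho G j; pose i' := (i.+1 %% N)%N.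
have cE : \sum_(j < N) (k (rho j.+1) * cross (omega (rho j.+1)) (side rho G j)
                      + k (rho j) * cross (omega (rho j)) (side rho G j)) =
          c * cross e (s i) + c * cross e (s i').
  (* Both contributions are expanded into sums with Kronecker factors, so that the comparison is
     term by term, including the vertex where the polygon closes. *)
  rewrite -(@sum_delta _ N i (fun j => c * cross e (s j)))//.
  rewrite -(@sum_delta _ N i' (fun j => c * cross e (s j)))//.
  rewrite -big_split/=; apply: eq_bigr => j _.
  rewrite !kc//; last exact: ltnW.
  by rewrite /omega hat_right// hat_left// /cross !mxE /s; ring.
have dE : \sum_(j < N) dot (side rho G j) (side rho omega j) / enorm (side rho G j) =
          dot (s i) e / enorm (s i) - dot (s i') e / enorm (s i').
  rewrite -(@sum_delta _ N i (fun j => dot (s j) e / enorm (s j)))//.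
  rewrite -(@sum_delta _ N i' (fun j => dot (s j) e / enorm (s j)))//.
  rewrite -sumrB; apply: eq_bigr => j _.
  by rewrite {2}/side /omega hat_right// hat_left// -scalerBl dotZr /s; ring.
have := eq0 _ oV; rewrite /nodal_curvature_form cE dE /s /i'.
by move=> /eqP; rewrite -oppr_eq0 => /eqP <-; ring.
Qed.

(** * Geometry of two consecutive sides *)

(** Here [p] and [q] are the unit directions and [L] and [M] the lengths of the sides; the last two
    hypotheses are the coordinates of the vector identity. The conclusions are half-angle formulas:
    the turning angle t satisfies tan (t / 2) = - k L. *)
Lemma corner_algebra (R : realType) (k L M p0 p1 q0 q1 : R) :
  0 < L -> 0 < M -> k != 0 ->
  p0 ^+ 2 + p1 ^+ 2 = 1 -> q0 ^+ 2 + q1 ^+ 2 = 1 ->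
  k * (L * p1 + M * q1) = - (p0 - q0) -> k * (L * p0 + M * q0) = p1 - q1 ->
  [/\ L = M,
      p0 * q0 + p1 * q1 = (1 - (k * L) ^+ 2) / (1 + (k * L) ^+ 2) &
      p0 * q1 - p1 * q0 = - (k * L) * (1 + (p0 * q0 + p1 * q1))].
Proof.
move=> L0 M0 k0 pp qq e1 e2.
(* Dot product of the identity with [p]. *)
have e3 : 1 - (p0 * q0 + p1 * q1) = - (k * M) * (p0 * q1 - p1 * q0).
  have -> : 1 - (p0 * q0 + p1 * q1) = (p0 - q0) * p0 + (p1 - q1) * p1.
    by rewrite -{1}pp; ring.
  by rewrite -e2 -[p0 - q0]opprK -e1; ring.
(* Dot product with [p + q], which is orthogonal to [p - q] because both are unit vectors. *)
have e4 : k * (L - M) * (p0 * q1 - p1 * q0) = 0.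
  have : (p0 - q0) * (p0 + q0) + (p1 - q1) * (p1 + q1) = 0.
    by transitivity (p0 ^+ 2 + p1 ^+ 2 - (q0 ^+ 2 + q1 ^+ 2)); [ring|rewrite pp qq subrr].
  by rewrite -e2 -[p0 - q0]opprK -e1 => <-; ring.
have LM : L = M.
  move/eqP: e4; rewrite !mulf_eq0 (negbTE k0)/= => /orP[|/eqP s0].
    by rewrite subr_eq0 => /eqP.
  (* If the cross product is 0, then [e3] gives p . q = 1, so p = q. The identity becomes k (L + M)
     q = 0, impossible for a unit vector. *)
  rewrite s0 mulr0 in e3.
  have pq : (p0 - q0) ^+ 2 + (p1 - q1) ^+ 2 = 0.
    transitivity (p0 ^+ 2 + p1 ^+ 2 + (q0 ^+ 2 + q1 ^+ 2) - 2 * (p0 * q0 + p1 * q1)).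
      by ring.
    by rewrite pp qq; lra.
  move/eqP: pq; rewrite paddr_eq0 ?sqr_ge0// !sqrf_eq0 !subr_eq0.
  move=> /andP[/eqP pq0 /eqP pq1]; exfalso.
  move: e1 e2; rewrite pq0 pq1 !subrr oppr0 -!mulrDl => /eqP.
  rewrite !mulf_eq0 (negbTE k0) gt_eqF ?addr_gt0//= => /eqP q10 /eqP.
  rewrite !mulf_eq0 (negbTE k0) gt_eqF ?addr_gt0//= => /eqP q00.
  by move: qq; rewrite q10 q00; lra.
subst M.
(* Cross product of [p] with [p - q], now that both lengths are [L]. *)
have e5 : p0 * q1 - p1 * q0 = - (k * L) * (1 + (p0 * q0 + p1 * q1)).
  transitivity (- (p0 * (p1 - q1) - p1 * (p0 - q0))); first by ring.
  by rewrite -e2 -[p0 - q0]opprK -e1 -{1}pp; ring.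
split=> //.
have pos : 0 < 1 + (k * L) ^+ 2 by rewrite ltr_pwDl ?ltr01// sqr_ge0.
apply: (mulIf (lt0r_neq0 pos)); rewrite divfK ?lt0r_neq0//.
rewrite e5 in e3; move: e3; set d := p0 * q0 + _ => e3.
have h : 1 - d = (k * L) ^+ 2 * (1 + d) by rewrite e3; ring.
by rewrite [LHS]mulrDr mulr1; move: h; rewrite mulrDr mulr1 [d * _]mulrC; lra.
Qed.

Lemma unit_dir (R : realType) (u : 'rV[R]_2) : u != 0 ->
  (u 0 0 / enorm u) ^+ 2 + (u 0 1 / enorm u) ^+ 2 = 1.
Proof.
move=> u0; rewrite !expr_div_n -mulrDl -enorm_sqr divff// sqrf_eq0.
by rewrite enorm_eq0.
Qed.

Lemma corner_equal (R : realType) (k : R) (u v : 'rV[R]_2) :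
  u != 0 -> v != 0 -> k != 0 ->
  (forall e, k * (cross e u + cross e v)
             + dot u e / enorm u - dot v e / enorm v = 0) ->
  [/\ enorm u = enorm v,
      dot u v = enorm u ^+ 2 *
        ((1 - (k * enorm u) ^+ 2) / (1 + (k * enorm u) ^+ 2)) &
      cross u v = - (k * enorm u) * (enorm u ^+ 2 + dot u v)].
Proof.
move=> u0 v0 k0 eqe.
have L0 : 0 < enorm u by rewrite enorm_gt0.
have M0 : 0 < enorm v by rewrite enorm_gt0.
have Ln := lt0r_neq0 L0; have Mn := lt0r_neq0 M0.
have dE (w : 'rV[R]_2) : (dot w (delta_mx 0 0) = w 0 0) * (dot w (delta_mx 0 1) = w 0 1)
    * (cross (delta_mx 0 0) w = w 0 1) * (cross (delta_mx 0 1) w = - w 0 0).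
  by rewrite !dotE /cross !mxE/=; do !split; ring.
(* Testing with the two basis vectors yields the coordinates of the identity. *)
have e1 := eqe (delta_mx 0 0); have e2 := eqe (delta_mx 0 1).
rewrite !dE in e1 e2.
have [||LM d c] := @corner_algebra _ k (enorm u) (enorm v) (u 0 0 / enorm u)
   (u 0 1 / enorm u) (v 0 0 / enorm v) (v 0 1 / enorm v) L0 M0 k0
   (unit_dir u0) (unit_dir v0).
- rewrite ![enorm _ * _]mulrC !divfK//; lra.
- rewrite ![enorm _ * _]mulrC !divfK//; lra.
have dd : dot u v = enorm u ^+ 2 *
    (u 0 0 / enorm u * (v 0 0 / enorm v) + u 0 1 / enorm u * (v 0 1 / enorm v)).
  by rewrite dotE -LM; field.
split=> //; first by rewrite dd d.
transitivity (enorm u ^+ 2 *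
    (u 0 0 / enorm u * (v 0 1 / enorm v) - u 0 1 / enorm u * (v 0 0 / enorm v))).
  by rewrite /cross -LM; field.
by rewrite c dd; ring.
Qed.

(** * Regularity of the equilibrium polygon *)

(** Every side is its length times one common direction, hence lies on the line spanned by [h 0].
    This excludes zero curvature at the equilibrium. *)
Lemma parallel_sides_dim (R : realType) (N : nat) (h : nat -> 'rV[R]_2) :
  (forall i, (i.+1 < N)%N ->
     (enorm (h i))^-1 *: h i = (enorm (h i.+1))^-1 *: h i.+1) ->
  (forall i, (i < N)%N -> h i != 0) ->
  (\dim <<[seq h j | j <- iota 0 N]>>%VS <= 1)%N.
Proof.
move=> par h0.
have dir i : (i < N)%N -> (enorm (h i))^-1 *: h i = (enorm (h 0%N))^-1 *: h 0%N.
  elim: i => // i IH iN; rewrite -par//; apply: IH; exact: ltnW.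
have sub : (<<[seq h j | j <- iota 0 N]>> <= <[h 0%N]>)%VS.
  apply/span_subvP => _ /mapP[j + ->]; rewrite mem_iota add0n => /= jN.
  have -> : h j = enorm (h j) *: ((enorm (h j))^-1 *: h j).
    by rewrite scalerA divff ?scale1r// enorm_eq0 h0.
  by rewrite dir// !memvZ// memv_line.
by apply: leq_trans (dimvS sub) _; rewrite dim_vline leq_b1.
Qed.

Lemma equilibrium_regular (R : realType) (N : nat) (rho : nat -> R)
    (X : R -> 'rV[R]_2) (k : R) :
  (3 <= N)%N -> nondegenerate_sides N rho X ->
  \dim <<[seq side rho X j | j <- iota 0 N]>>%VS = 2%N ->
  (forall i e, (i < N)%N ->
    k * (cross e (side rho X i) + cross e (side rho X (i.+1 %% N)))
    + dot (side rho X i) e / enorm (side rho X i)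
    - dot (side rho X (i.+1 %% N)) e / enorm (side rho X (i.+1 %% N)) = 0) ->
  regular_polygon N rho X.
Proof.
move=> N3 nd dim2 eqs.
have N0 : (0 < N)%N by exact: leq_trans N3.
have k0 : k != 0.
  apply/eqP => k0; suff : (\dim <<[seq side rho X j | j <- iota 0 N]>>%VS <= 1)%N.
    by rewrite dim2.
  apply: parallel_sides_dim => // i iN.
  (* For [k = 0] the identity is tested with the difference [w] of the two unit directions itself,
     which gives dot w w = 0. *)
  apply/eqP; rewrite -subr_eq0 -enorm_eq0; apply/eqP; set w := _ - _.
  have := eqs i w (ltnW iN); rewrite modn_small// k0 mul0r add0r.
  have -> : dot (side rho X i) w / enorm (side rho X i)
      - dot (side rho X i.+1) w / enorm (side rho X i.+1) = dot w w.
    by rewrite {3}/w !dotE !mxE; ring.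
  by rewrite /enorm => ->; rewrite sqrtr0.
have corner i : (i < N)%N -> _ := fun iN => @corner_equal _ k _ _ (nd i iN)
  (nd _ (ltn_pmod _ N0)) k0 (fun e => eqs i e iN).
have len i : (i < N)%N -> enorm (side rho X i) = enorm (side rho X 0%N).
  elim: i => // i IH iN; rewrite -(IH (ltnW iN)).
  by have [-> _ _] := corner i (ltnW iN); rewrite modn_small.
split=> [i j iN jN|i j iN jN]; first by rewrite !len.
pose L := enorm (side rho X 0%N).
(* With all lengths equal to [L], the dot and cross products at a vertex depend on [k] and [L] only,
   and so does the angle, including the branch chosen by the sign of the cross product. *)
have angle l : (l < N)%N ->
    interior_angle N rho X l =
    let d := L ^+ 2 * ((1 - (k * L) ^+ 2) / (1 + (k * L) ^+ 2)) in
    let a := acos (- d / (L * L)) in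
    if 0 <= k * L * (L ^+ 2 + d) then a else 2 * pi - a.
  move=> lN; have [LM dE cE] := corner l lN.
  rewrite len// -/L in LM dE cE; rewrite dE in cE.
  rewrite /interior_angle /ccw_angle -LM.
  have -> (u v : 'rV[R]_2) : dot (- u) v = - dot u v by rewrite !dotE !mxE; ring.
  have -> (u v : 'rV[R]_2) : cross (- u) v = - cross u v.
    by rewrite /cross !mxE; ring.
  have -> : enorm (- side rho X l) = L.
    by rewrite /enorm -scaleN1r dotZl dotZr !mulN1r opprK; exact: len.
  by rewrite dE cE mulNr opprK.
by rewrite !angle.
Qed.

(** * The mesh ratio and the conclusion *)

(** The initial value also varies with [t], because the maximum and minimum of the sides start from
    the length of side 0. *)
Lemma cvg_bigop_seed (R : realType) (op : R -> R -> R)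
    (opc : continuous (fun x : R * R => op x.1 x.2))
    (T : Type) (F : set_system T) {FF : Filter F} (n : nat)
    (x : T -> R) (a : R) (f : T -> 'I_n -> R) (l : 'I_n -> R) :
  x t @[t --> F] --> a -> (forall i, f t i @[t --> F] --> l i) ->
  \big[op/x t]_(i < n) f t i @[t --> F] --> \big[op/a]_(i < n) l i.
Proof.
move=> xa fl; elim: (index_enum 'I_n) => [|i r IH].
  by rewrite big_nil; under eq_cvg do rewrite big_nil.
rewrite big_cons; under eq_cvg do rewrite big_cons.
exact: (cvg_comp _ _ (cvg_pair (fl i) IH) (opc (l i, _))).
Qed.

Lemma big_const_id (R : realType) (op : R -> R -> R) (n : nat) (f : 'I_n -> R)
    (x : R) : op x x = x -> (forall i, f i = x) -> \big[op/x]_(i < n) f i = x.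
Proof. by move=> opx fx; elim/big_rec: _ => // i y _ ->; rewrite fx. Qed.

Theorem theorem2p2 (R : realType) (N : nat) (rho : nat -> R) (tau : R)
    (X : nat -> R -> 'rV[R]_2) (kappa : nat -> R -> R)
    (Xt : nat -> R -> 'rV[R]_2) (Xe : R -> 'rV[R]_2) (kappae : R -> R)
    (N_ge3 : (3 <= N)%N) (rhoP : partition01 N rho) (tau_gt0 : 0 < tau)
    (solP : bgn_pc_solution N rho tau X kappa Xt)
    (X_sides : forall m, nondegenerate_sides N rho (X m))
    (Xt_sides : forall m, nondegenerate_sides N rho (Xt m))
    (XeP : Vh2 N rho Xe) (kappaeP : Vh N rho kappae)
    (X_cvg : {uniform `[0, 1], X m @[m --> \oo] --> Xe})
    (kappa_cvg : {uniform `[0, 1], kappa m @[m --> \oo] --> kappae})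
    (Xt_cvg : {uniform `[0, 1], Xt m @[m --> \oo] --> Xe})
    (min_gt0 : 0 < min_side N rho Xe)
    (span_dim : \dim <<[seq side rho Xe j | j <- iota 0 N]>>%VS = 2%N) :
  [/\ mesh_ratio N rho (X m) @[m --> \oo] --> mesh_ratio N rho Xe,
      mesh_ratio N rho Xe = 1
    & regular_polygon N rho Xe].
Proof.
have N0 : (0 < N)%N by exact: leq_trans N_ge3.
have nd : nondegenerate_sides N rho Xe.
  move=> j jN; rewrite -enorm_gt0; apply: lt_le_trans min_gt0 _.
  exact: (bigmin_le _ (Ordinal jN)).
have Xn := uniform_nodal_cvg rhoP X_cvg.
have kn := uniform_nodal_cvg rhoP kappa_cvg.
have Xtn := uniform_nodal_cvg rhoP Xt_cvg.
have [spaces steps] := solP.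
(* The velocity, averaged curvature and averaged curve of the corrector. *)
pose v m r := tau^-1 *: (X m.+1 r - X m r).
pose k m r := (kappa m.+1 r + kappa m r) / 2.
pose Z m r := 2^-1 *: (X m.+1 r + X m r).
have shift (V : ptopologicalType) (f : nat -> R -> V) fe :
    nodal_cvg N rho f fe -> nodal_cvg N rho (fun m => f m.+1) fe.
  by move=> fc j jN; rewrite (cvg_shiftS (fun m => f m (rho j))); exact: fc.
(* Consecutive iterates have the same limit and [tau] is fixed. *)
have vn : nodal_cvg N rho v (fun=> 0).
  move=> j jN; rewrite -[0](scaler0 _ tau^-1) -(subrr (Xe (rho j))).
  by apply: cvgZl_tmp; apply: cvgB; [exact: (shift _ _ _ Xn)|exact: Xn].
have kcn : nodal_cvg N rho k kappae.
  move=> j jN; rewrite [X in _ --> X](_ : _ = (kappae (rho j) + kappae (rho j)) / 2); last by lra.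
  by apply: cvgMr_tmp; apply: cvgD; [exact: (shift _ _ _ kn)|exact: kn].
have Zn : nodal_cvg N rho Z Xe.
  move=> j jN.
  have -> : Xe (rho j) = 2^-1 *: (Xe (rho j) + Xe (rho j)).
    by apply/rowP => i; rewrite !mxE; lra.
  by apply: cvgZl_tmp; apply: cvgD; [exact: (shift _ _ _ Xn)|exact: Xn].
have forms m :
  (forall phi, Vh N rho phi -> nodal_velocity_form N rho (Xt m) (v m) (k m) phi = 0) /\
  (forall omega, Vh2 N rho omega ->
     nodal_curvature_form N rho (Xt m) (k m) (Z m) omega = 0).
  have XA l : pw_affine N rho (X l) by exact: Vh2_pw_affine rhoP (spaces l).1.
  have kA l := Vh_pw_affine rhoP (spaces l).2.
  have [[eta [XtV _ _]] weak] := steps m.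
  apply: weak_equations_nodal weak => //.
  - exact: Vh2_pw_affine.
  - apply: pw_affineZ; apply: pw_affineD => //.
    by under eq_fun do rewrite -scaleN1r; exact: pw_affineZ.
  - rewrite (_ : (fun r => _) = fun r => 2^-1 *: (kappa m.+1 r + kappa m r : R^o)).
      by apply: pw_affineZ; exact: pw_affineD.
    by apply/funext => r; rewrite mulrC.
  - by apply: pw_affineZ; exact: pw_affineD.
(* A sequence of zeros converges to the form at the equilibrium, so this form is 0. *)
have vel0 phi : Vh N rho phi -> nodal_velocity_form N rho Xe (fun=> 0) kappae phi = 0.
  move=> phiV.
  have := nodal_velocity_form_cvg (phi := phi) nd Xtn vn kcn.
  under eq_cvg do rewrite (forms _).1//.
  by move=> /(cvg_unique (@Rhausdorff R) (cvg_cst 0)) <-.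
have cur0 omega : Vh2 N rho omega -> nodal_curvature_form N rho Xe kappae Xe omega = 0.
  move=> oV.
  have := nodal_curvature_form_cvg (omega := omega) nd Xtn Zn kcn.
  under eq_cvg do rewrite (forms _).2//.
  by move=> /(cvg_unique (@Rhausdorff R) (cvg_cst 0)) <-.
(* Tested with [kappae], the form reduces to a sum of squared nodal increments divided by lengths;
   each term is nonnegative, so every increment vanishes. *)
have kconst j : (j <= N)%N -> kappae (rho j) = kappae (rho 0%N).
  have := vel0 _ kappaeP; rewrite /nodal_velocity_form.
  rewrite big1 ?mulr0 ?oppr0 ?add0r; last first.
    by move=> i _; rewrite /cross !mxE; ring.
  move=> /eqP; rewrite psumr_eq0; last first.
    by move=> i _; rewrite -expr2 divr_ge0 ?sqr_ge0 ?sqrtr_ge0.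
  move=> /allP z; elim: j => // j IH jN; rewrite -(IH (ltnW jN)).
  have := z (Ordinal jN) (mem_index_enum _); rewrite /= mulf_eq0 invr_eq0.
  by rewrite enorm_eq0 (negbTE (nd _ jN)) orbF -expr2 sqrf_eq0 subr_eq0 => /eqP.
have reg : regular_polygon N rho Xe.
  apply: (@equilibrium_regular _ _ _ _ (kappae (rho 0%N) / 2)) => // i e iN.
  exact: nodal_curvature_corner rhoP iN kconst cur0.
have sidec j : (j < N)%N ->
    enorm (side rho (X m) j) @[m --> \oo] --> enorm (side rho Xe j).
  by move=> jN; apply: cvg_enorm; exact: (cvg_side Xn).
split=> //.
  apply: cvgM.
    apply: cvg_bigop_seed => //; [exact: max_continuous|exact: sidec|].
    by move=> i; exact: sidec.
  apply: cvgV; first exact: lt0r_neq0.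
  apply: cvg_bigop_seed => //; [exact: min_continuous|exact: sidec|].
  by move=> i; exact: sidec.
(* By regularity the maximum and the minimum both equal the length of side 0. *)
rewrite /mesh_ratio /max_side /min_side !big_const_id ?maxxx ?minxx//.
- by rewrite divff// enorm_eq0 nd.
- by move=> i; exact: reg.1.
- by move=> i; exact: reg.1.
Qed.
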